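(* Consider a binary-response generalized linear mixed model with link $F^{-1}$, where $F$ is a cumulative distribution function on $\mathbb{R}$: given $\bm\beta\in\mathbb{R}^p$ and $\bm u=(\bm u_1^T,\dots,\bm u_r^T)^T\in\mathbb{R}^q$ ($\bm u_j\in\mathbb{R}^{q_j}$, $q=q_1+\dots+q_r$), the responses $Y_1,\dots,Y_n$ are independent with $P(Y_i=1)=F(\bm x_i^T\bm\beta+\bm z_i^T\bm u)$, and $\bm u_j\overset{ind}{\sim}N(\bm 0,\tau_j^{-1}\bm I_{q_j})$. Put the improper prior $\pi(\bm\beta)\propto 1$ and independent priors $\pi(\tau_j)\propto e^{-b_j\tau_j}\tau_j^{a_j-1}$ on $\tau_j>0$, $j=1,\dots,r$. Assume the design structure described in the context, and suppose: (B1) for each $j=1,\dots,r$, either ($a_j<0$, $b_j=0$ and $q_j\ge 2$) or $b_j>0$; (B2) $2a_j+q_j-1>0$ for $j=1,\dots,r$; (B3) $\tilde{\bm W}$ has full column rank; (B4) there exists a vector $\bm e\in\mathbb{R}^n$ with all entries strictly positive such that $\bm e^T\tilde{\bm W}^*=\bm 0$; (B5) $E|\delta|^{p+t}<\infty$ where $\delta\sim F$ and $t=\sum_{j=1}^r[-2a_j I(b_j=0)+(q_j-1)I(b_j>0)]$. Then for the observed $\bm y=(y_1,\dots,y_n)\in\{0,1\}^n$, $$\int_{\mathbb{R}_+^r}\int_{\mathbb{R}^q}\int_{\mathbb{R}^p}\prod_{i=1}^n[F(\bm x_i^T\bm\beta+\bm z_i^T\bm u)]^{y_i}[1-F(\bm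 x_i^T\bm\beta+\bm z_i^T\bm u)]^{1-y_i}\prod_{j=1}^r\tau_j^{q_j/2+a_j-1}\exp\Big[-\tau_j\Big(b_j+\tfrac12\bm u_j^T\bm u_j\Big)\Big]\,d\bm\beta\,d\bm u\,d\bm\tau<\infty,$$ i.e. the joint posterior density of $(\bm\beta,\bm\tau)$ is proper.
   Context: Data: $\bm y=(y_1,\dots,y_n)^T\in\{0,1\}^n$; $\bm x_i\in\mathbb{R}^p$, $\bm z_i\in\mathbb{R}^q$ are known; $\bm X$ is the $n\times p$ matrix with rows $\bm x_i^T$, $\bm Z$ the $n\times q$ matrix with rows $\bm z_i^T$. Design structure: the first column of $\bm X$ is the all-ones vector (intercept $\beta_0$ in $\bm\beta=(\beta_0,\dots,\beta_{p-1})^T$); $\bm Z=(\bm Z_1,\dots,\bm Z_r)$ where $\bm Z_j$ is $n\times q_j$ with $(i,k)$ entry equal to 1 if observation $i$ is at level $k$ of the $j$th random effect $\bm u_j=(u_{j1},\dots,u_{jq_j})^T$ and 0 otherwise (each observation is at exactly one level of each random effect). $\tilde{\bm Z}_j$ is $\bm Z_j$ with its first column deleted, $\tilde{\bm Z}=(\tilde{\bm Z}_1,\dots,\tilde{\bm Z}_r)$, and $\tilde{\bm W}=(\bm X,\tilde{\bm Z})$ with $i$th row $\tilde{\bm w}_i^T$. Let $c_i=1-2y_i$ (so $c_i=1$ if $y_i=0$ and $c_i=-1$ if $y_i=1$); $\tilde{\bm W}^*$ is the matrix whose $i$th row is $c_i\tilde{\bm w}_i^T$. $\mathbb{R}_+=(0,\infty)$.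 *)

(* Defs.v *)
From HB Require Import structures.
From mathcomp Require Import all_boot all_order all_algebra.
From mathcomp Require Import all_classical all_reals all_analysis.
Set Implicit Arguments. Unset Strict Implicit. Unset Printing Implicit Defensive.
Import Order.TTheory GRing.Theory Num.Theory.
Local Open Scope classical_set_scope.
Local Open Scope ring_scope.

Section GLMMDefs.
Variable R : realType.

Definition cons_pt (k : nat) (x : R) (v : 'I_k -> R) : 'I_k.+1 -> R :=
  fun i => if unlift ord0 i is Some j then v j else x.

(* Iterated Lebesgue integral over A^k (A ⊆ R) of f : R^k -> \bar R.
   For nonnegative measurable f this equals (Tonelli) the integral of f
   with respect to k-dimensional Lebesgue measure restricted to A^k. *)
Fixpoint iter_integral (A : set R) (k : nat) :
    (('I_k -> R) -> \bar R) -> \bar R :=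
  match k with
  | 0 => fun f => f (fun _ => 0)
  | k'.+1 => fun f =>
      (\int[@lebesgue_measure R]_(x in A)
         iter_integral A (fun v => f (cons_pt x v)))%E
  end.

(* Z_j : n x q_j incidence matrix of the j-th random effect, given the
   level lev j i of observation i for that effect *)
Definition Zj (n : nat) (qj : nat) (levj : 'I_n -> 'I_qj) : 'M[R]_(n, qj) :=
  \matrix_(i < n, k < qj) ((levj i == k)%:R).

Definition Zmat (n r : nat) (qj : 'I_r -> nat)
    (lev : forall j : 'I_r, 'I_n -> 'I_(qj j)) : 'M[R]_(n, \sum_(j < r) qj j) :=
  @mxrow R r qj n (fun j => Zj (lev j)).

(* Z~_j : Z_j with its first column deleted (column k of Z~_j is column k+1
   of Z_j) *)
Definition Ztj (n : nat) (qj : nat) (levj : 'I_n -> 'I_qj) : 'M[R]_(n, qj.-1) :=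
  \matrix_(i < n, k < qj.-1) ((val (levj i) == k.+1)%:R).

Definition Ztmat (n r : nat) (qj : 'I_r -> nat)
    (lev : forall j : 'I_r, 'I_n -> 'I_(qj j)) :
    'M[R]_(n, \sum_(j < r) (qj j).-1) :=
  @mxrow R r (fun j => (qj j).-1) n (fun j => Ztj (lev j)).

Definition Wt (n p r : nat) (X : 'M[R]_(n, p)) (qj : 'I_r -> nat)
    (lev : forall j : 'I_r, 'I_n -> 'I_(qj j)) :
    'M[R]_(n, p + \sum_(j < r) (qj j).-1) :=
  row_mx X (Ztmat lev).

Definition cy (n : nat) (y : 'I_n -> bool) (i : 'I_n) : R := 1 - 2 * (y i)%:R.

Definition Wstar (n m : nat) (y : 'I_n -> bool) (W : 'M[R]_(n, m)) : 'M[R]_(n, m) :=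
  \matrix_(i < n, k < m) (cy y i * W i k).

Definition t_exp (r : nat) (qj : 'I_r -> nat) (a b : 'I_r -> R) : R :=
  \sum_(j < r) (- 2 * a j * ((b j == 0)%R)%:R + ((qj j)%:R - 1) * ((0 < b j)%R)%:R).

End GLMMDefs.
Arguments iter_integral {R} A k f.
Arguments Zmat {R n r qj} lev.
Arguments Ztmat {R n r qj} lev.
Arguments Wt {R n p r} X {qj} lev.
Arguments Wstar {R n m} y W.
Arguments t_exp {R r} qj a b.

(* Main.v *)
(** Write [theta] for [beta] with the reference levels of all random effects
    added to the intercept, followed by the contrasts [u_jk - u_j1]; then
    [X beta + Z u = W theta].  By (B3) and (B4) there is [K] such that every
    [theta] has an observation [i] with [|theta|_oo <= K c_i eta_i], so the
    likelihood is at most [P (|delta| >= |theta|_oo / K)].  Cutting the law of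
    [delta] into the shells [N <= |x| < N + 1] of mass [m_N] bounds this by
    [sum_N m_N 1{|theta|_oo <= rho_N}] with [rho_N = K (N + 1)], a series of
    functions that are integrated one coordinate at a time: each [beta_k] gives
    [2 rho_N], each [u_j1] gives [g = sqrt (2 pi / tau_j)], every other [u_jk]
    gives at most [min (2 rho_N) g], and the integral over [tau_j] is then
    [O(rho_N ^ t_j)], where [t_j] is the [j]-th term of [t].  What is left,
    [sum_N m_N rho_N ^ (p + t)], is finite by (B5). *)

Require Import Defs.
From HB Require Import structures.
From mathcomp Require Import all_boot all_order all_algebra.
From mathcomp Require Import all_classical all_reals all_analysis.
From mathcomp Require Import measurable_realfun ring lra zify.
Set Implicit Arguments. Unset Strict Implicit. Unset Printing Implicit Defensive.
Import Order.TTheory GRing.Theory Num.Theory.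
Import numFieldNormedType.Exports.
Local Open Scope classical_set_scope.
Local Open Scope ring_scope.

(** * Linear algebra: one observation controls all coordinates *)

(** The signed entries of [W x] have a vanishing sum with positive weights, so their maximum is
    nonnegative and controls the negative entries as well. A left inverse of [W] carries this
    control over to [x]. *)
Lemma normr_le_signed_coordinate (R : realFieldType) (n m : nat) (y : 'I_n -> bool)
    (W : 'M[R]_(n, m)) :
  (0 < m)%N -> \rank W = m ->
  (exists e : 'rV[R]_n, (forall i, 0 < e ord0 i) /\
    e *m (\matrix_(i, k) ((1 - 2 * (y i)%:R) * W i k)) = 0) ->
  exists2 K, 0 < K & forall x : 'cV[R]_m, exists i, forall k,
    `|x k ord0| <= K * ((1 - 2 * (y i)%:R) * (W *m x) i ord0).
Proof.
move=> m_gt0 rkW [e [e_gt0 eW]].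
have n_gt0 : (0 < n)%N by rewrite (leq_trans m_gt0)// -rkW rank_leq_row.
have /row_fullP[L LW] : row_full W by rewrite /row_full rkW.
pose sgn i : R := 1 - 2 * (y i)%:R.
have normr_sgn i : `|sgn i| = 1.
  rewrite /sgn; case: (y i); rewrite /= ?mulr1 ?mulr0 ?subr0 ?normr1//.
  by rewrite -[2]/(1 + 1) opprD addrA subrr add0r normrN1.
(* If [z i] is the largest signed entry, then [- e_l z_l], the weighted sum of the others, is at
   most [E * z i]; hence [D] bounds every [E / e_l]. [N] dominates the absolute row sums of the left
   inverse [L]. *)
pose E := \sum_i e ord0 i.
pose D := 1 + \sum_i E / e ord0 i.
pose N := 1 + \sum_k \sum_i `|L k i|.
have E_ge0 : 0 <= E by apply: sumr_ge0 => i _; exact: ltW.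
have Ee_ge0 i : 0 <= E / e ord0 i by rewrite divr_ge0// ltW.
have D_gt0 : 0 < D by rewrite ltr_pwDl// sumr_ge0.
have N_gt0 : 0 < N.
  by rewrite ltr_pwDl// sumr_ge0// => k _; rewrite sumr_ge0.
exists (N * D); first exact: mulr_gt0.
move=> x.
pose z i := sgn i * (W *m x) i ord0.
have ez0 : \sum_i e ord0 i * z i = 0.
  transitivity ((e *m (\matrix_(i, k) (sgn i * W i k)) *m x) ord0 ord0).
    rewrite -mulmxA !mxE; apply: eq_bigr => i _; rewrite !mxE /z mxE.
    congr (_ * _); rewrite mulr_sumr; apply: eq_bigr => k _.
    by rewrite !mxE mulrA.
  by rewrite eW mul0mx mxE.
pose i0 : 'I_n := Ordinal n_gt0.
have [i _ zi] : exists2 i, true & forall j, z j <= z i.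
  by case: (@arg_maxP _ _ _ i0 predT z) => // i _ iP; exists i => // j; exact: iP.
exists i => k; rewrite -/(sgn i) -/(z i).
have zi_ge0 : 0 <= z i.
  rewrite leNgt; apply/negP => zi_lt0.
  suff : \sum_i e ord0 i * z i < 0 by rewrite ez0 ltxx.
  rewrite (bigD1 i)//= -[ltRHS]addr0 ltr_leD//.
    by rewrite pmulr_rlt0.
  apply: sumr_le0 => j _; rewrite pmulr_rle0//.
  exact: le_trans (zi j) (ltW zi_lt0).
(* A weighted sum of the [z l] vanishes, so the largest one bounds them all. *)
have z_le l : `|z l| <= D * z i.
  rewrite ler_norml; apply/andP; split.
    have : - (e ord0 l * z l) <= E * z i.
      rewrite (bigD1 l)//= in ez0.
      have -> : - (e ord0 l * z l) = \sum_(j | j != l) e ord0 j * z j.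
        by apply/eqP; rewrite eq_sym -addr_eq0 addrC ez0.
      rewrite /E [X in _ <= X * _](bigD1 l)//= mulrDl ler_wpDl//.
        by rewrite mulr_ge0// ltW.
      rewrite mulr_suml; apply: ler_sum => j _.
      by rewrite ler_wpM2l// ltW.
    rewrite -mulrN mulrC -ler_pdivlMr// mulrAC lerNl => h.
    apply: le_trans h; rewrite lerN2.
    rewrite ler_wpM2r// /D (bigD1 l)//= addrCA lerDl addr_ge0//.
    by rewrite sumr_ge0.
  rewrite (le_trans (zi l))// ler_peMl//.
  by rewrite /D lerDl sumr_ge0.
have -> : x k ord0 = \sum_l L k l * (W *m x) l ord0.
  by rewrite -[in LHS](mul1mx x) -LW -mulmxA mxE.
apply: le_trans (ler_norm_sum _ _ _) _.
apply: (@le_trans _ _ (\sum_l `|L k l| * (D * z i))).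
  apply: ler_sum => l _; rewrite normrM ler_wpM2l//.
  by rewrite -(mul1r `|_|) -(normr_sgn l) -normrM z_le.
rewrite -mulr_suml -mulrA ler_wpM2r ?(mulr_ge0 (ltW D_gt0) zi_ge0)//.
rewrite /N (bigD1 k)//= addrCA lerDl addr_ge0//.
by rewrite sumr_ge0// => j _; rewrite sumr_ge0.
Qed.

(** The columns of each [Z_j] sum to the all-ones vector, which is the intercept column. Moving
    [base j] from the [j]-th effect to the intercept therefore leaves the linear predictor
    unchanged, and the previous lemma applies to the reduced matrix, which has full column rank. *)
Lemma glmm_dominating_observation (R : realType) (n p r : nat) (qj : 'I_r -> nat)
    (X : 'M[R]_(n, p)) (lev : forall j : 'I_r, 'I_n -> 'I_(qj j))
    (y : 'I_n -> bool) (p_gt0 : (0 < p)%N) (q_gt0 : forall j, (0 < qj j)%N) :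
  (forall (i : 'I_n) (k : 'I_p), val k = 0%N -> X i k = 1) ->
  \rank (Wt X lev) = (p + \sum_(j < r) (qj j).-1)%N ->
  (exists e : 'rV[R]_n, (forall i, 0 < e ord0 i) /\ e *m Wstar y (Wt X lev) = 0) ->
  exists2 K, 0 < K & forall (beta : 'cV[R]_p) (u : 'cV[R]_(\sum_(j < r) qj j)),
    let base j := u (tagnat.Rank j (Ordinal (q_gt0 j))) ord0 in
    exists i,
    let s := K * (cy R y i * (X *m beta + Zmat lev *m u) i ord0) in
    (forall k, `|beta k ord0 + (if val k == 0%N then \sum_j base j else 0)| <= s) /\
    (forall j (k : 'I_(qj j)), val k != 0%N ->
       `|u (tagnat.Rank j k) ord0 - base j| <= s).
Proof.
move=> X1 rkW eW.
have pq_gt0 : (0 < p + \sum_(j < r) (qj j).-1)%N by rewrite addn_gt0 p_gt0.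
have [K K_gt0 hK] := @normr_le_signed_coordinate R _ _ y _ pq_gt0 rkW eW.
exists K => // beta u base.
pose b' : 'cV[R]_p :=
  \col_k (beta k ord0 + (if val k == 0%N then \sum_j base j else 0)).
have Sq j (k : 'I_(qj j).-1) : (k.+1 < qj j)%N.
  by rewrite -ltn_predRL.
pose u' j : 'cV[R]_(qj j).-1 :=
  \col_k (u (tagnat.Rank j (Ordinal (Sq j k))) ord0 - base j).
have [i hi] := hK (col_mx b' (\mxcol_j u' j)).
exists i => s.
have etaE : Wt X lev *m col_mx b' (\mxcol_j u' j) = X *m beta + Zmat lev *m u.
  rewrite /Wt mul_row_col /Ztmat mul_mxrow_mxcol /Zmat -{1}(submxcolK u).
  rewrite mul_mxrow_mxcol; apply/matrixP => l l'; rewrite (ord1 l') {l'}.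
  have -> : b' = beta + \col_k (if val k == 0%N then \sum_j base j else 0).
    by apply/matrixP => k k'; rewrite !mxE (ord1 k').
  rewrite mulmxDr -addrA [LHS]mxE [RHS]mxE; congr (_ + _).
  rewrite mxE [X in X + _ = _](_ : _ = \sum_j base j); last first.
    rewrite mxE (bigD1 (Ordinal p_gt0))//= !mxE/= X1// mul1r.
    rewrite [X in _ + X]big1 ?addr0// => k k0; rewrite mxE ifF ?mulr0//.
    by apply/negbTE; apply: contra k0 => /eqP k0; apply/eqP/val_inj.
  rewrite !summxE -big_split/=; apply: eq_bigr => j _.
  rewrite !mxE [RHS](bigD1 (lev j l))//= !mxE eqxx mul1r.
  rewrite [X in _ = _ + X]big1 ?addr0; last first.
    by move=> k kl; rewrite !mxE eq_sym (negbTE kl) mul0r.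
  (* At the reference level the row of the reduced block is zero and only [base j] remains. At any
     other level exactly one contrast survives, and adding [base j] to it restores the original
     effect. *)
  have [lev0|lev0] := eqVneq (val (lev j l)) 0%N.
        rewrite [X in _ + X]big1 ?addr0 => [|k _]; last by rewrite !mxE lev0 mul0r.
    by rewrite /base; congr (u (tagnat.Rank j _) _); exact: val_inj.
  have kP : ((val (lev j l)).-1 < (qj j).-1)%N.
    by rewrite ltn_predRL prednK ?lt0n// ltn_ord.
  have levE : (val (lev j l) == (val (lev j l)).-1.+1) = true.
    by rewrite prednK ?lt0n ?eqxx.
  rewrite (bigD1 (Ordinal kP))//= !mxE/= levE mul1r.
  rewrite [X in _ + (_ + X)]big1 ?addr0 => [|k kl]; last first.
    rewrite !mxE; case: eqP => [kE|]; last by rewrite mul0r.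
    by case/eqP: kl; apply: val_inj => /=; rewrite kE.
  rewrite addrC subrK; congr (u (tagnat.Rank j _) _).
  by apply: val_inj => /=; rewrite prednK ?lt0n.
rewrite etaE in hi; split.
  move=> k; have := hi (lshift _ k).
  by rewrite col_mxEu mxE; apply.
move=> j k k0.
have kP : ((val k).-1 < (qj j).-1)%N by rewrite ltn_predRL prednK ?lt0n// ltn_ord.
have := hi (rshift _ (tagnat.Rank j (Ordinal kP))).
rewrite col_mxEd.
have -> : (\mxcol_j u' j) (tagnat.Rank j (Ordinal kP)) ord0 =
    u (tagnat.Rank j k) ord0 - base j.
  transitivity (submxcol (\mxcol_j u' j) j (Ordinal kP) ord0).
    by rewrite [RHS]mxE.
  rewrite mxcolK mxE; congr (u (tagnat.Rank j _) _ - _).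
  by apply: val_inj => /=; rewrite prednK ?lt0n.
by apply.
Qed.

(** * Bounds on iterated integrals *)

(* Unlike [ge0_le_integral], no measurability is assumed: the inner iterated
   integrals are not known to be measurable in the outer variables. *)
Lemma le_integral_nonmeasurable d (T : measurableType d) (R : realType)
    (mu : {measure set T -> \bar R}) (D : set T) (f1 f2 : T -> \bar R) :
  (forall x, D x -> (0 <= f1 x)%E) -> (forall x, D x -> (f1 x <= f2 x)%E) ->
  (\int[mu]_(x in D) f1 x <= \int[mu]_(x in D) f2 x)%E.
Proof.
move=> f1_ge0 f12; rewrite [leLHS]integral_mkcond [leRHS]integral_mkcond.
have f12' x : ((f1 \_ D) x <= (f2 \_ D) x)%E.
  by rewrite /patch; case: ifPn => // /set_mem; exact: f12.
have f1_ge0' x : (0 <= (f1 \_ D) x)%E.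
  by rewrite /patch; case: ifPn => // /set_mem; exact: f1_ge0.
have f2_ge0' x : (0 <= (f2 \_ D) x)%E by exact: le_trans (f12' x).
rewrite !ge0_integralTE//; apply: le_ereal_sup => _ [h hf1 <-].
by exists h => //= x; exact: le_trans (hf1 x) (f12' x).
Qed.

Section iter_integral_bounds.
Context {R : realType}.
Variables (A : set R).
Hypothesis mA : measurable A.

Lemma iter_integral_ge0 k (f : ('I_k -> R) -> \bar R) :
  (forall v, (forall i, A (v i)) -> (0 <= f v)%E) -> (0 <= iter_integral A k f)%E.
Proof.
elim: k f => [f f0|k IH f f0] /=; first by apply: f0; case.
apply: integral_ge0 => x Ax; apply: IH => v Av; apply: f0 => i.
by rewrite /cons_pt; case: unlift.
Qed.

(** The factor [g N i] may look only at coordinates before [i], which are fixed by outer integrals,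
    and its bound [M N i] is uniform in them. The coordinates can thus be integrated one after the
    other from the innermost outwards, term by term in the series. Measurability is asked of the
    factors [g] only, never of [f]. *)
Lemma iter_integral_series_le k (f : ('I_k -> R) -> \bar R) (c : nat -> R)
    (g : nat -> 'I_k -> ('I_k -> R) -> R -> R) (M : nat -> 'I_k -> R) :
  (forall N, 0 <= c N) ->
  (forall N i v x, 0 <= g N i v x) ->
  (forall N i v, measurable_fun A (g N i v)) ->
  (forall N (i : 'I_k) v w, (forall j : 'I_k, (j < i)%N -> v j = w j) -> g N i v = g N i w) ->
  (forall N i v, (\int[lebesgue_measure]_(x in A) (g N i v x)%:E <= (M N i)%:E)%E) ->
  (forall v, (forall i, A (v i)) ->
    (0 <= f v)%E /\ (f v <= \sum_(N <oo) (c N * \prod_i g N i v (v i))%:E)%E) ->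
  (iter_integral A k f <= \sum_(N <oo) (c N * \prod_i M N i)%:E)%E.
Proof.
elim: k f c g M => [|k IH] f c g M c_ge0 g_ge0 mg gE gM fP.
  have /fP[_ /le_trans] : forall i : 'I_0, A ((fun=> 0) i) by case.
  apply; apply: lee_nneseries => [N _ _|N _].
    by rewrite lee_fin big_ord0 mulr1.
  by rewrite !big_ord0.
have M_ge0 N i : 0 <= M N i.
  rewrite -lee_fin (le_trans _ (gM N i (fun=> 0)))// integral_ge0// => x _.
  by rewrite lee_fin.
pose g0 N : R -> R := g N ord0 (fun=> 0).
(* No coordinate precedes the first one, so its factor does not depend on [v] at all. *)
have gord0 N v : g N ord0 v = g0 N by apply: gE.
pose M' N : R := \prod_(i < k) M N (lift ord0 i).
have M'_ge0 N : 0 <= M' N by apply: prodr_ge0.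
have cons_lift x (v : 'I_k -> R) (i : 'I_k) : cons_pt x v (lift ord0 i) = v i.
  by rewrite /cons_pt liftK.
have cons_ord0 x (v : 'I_k -> R) : cons_pt x v ord0 = x.
  by rewrite /cons_pt unlift_none.
have A_cons x (v : 'I_k -> R) : A x -> (forall i, A (v i)) ->
    forall i, A (cons_pt x v i).
  by move=> Ax Av i; rewrite /cons_pt; case: unlift.
have step x : A x -> (iter_integral A k (fun v => f (cons_pt x v)) <=
    \sum_(N <oo) ((c N * M' N)%:E * (g0 N x)%:E))%E.
  move=> Ax.
  (* With the first coordinate frozen at [x], its factor [g0 N x] joins the coefficient of the
     series. *)
  have := IH (fun v => f (cons_pt x v)) (fun N => c N * g0 N x)
    (fun N i v => g N (lift ord0 i) (cons_pt x v)) (fun N i => M N (lift ord0 i)).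
  under [X in _ -> _ -> _ -> _ -> _ -> _ -> (_ <= X)%E]eq_eseriesr do
    rewrite mulrAC EFinM.
  apply => //.
  - by move=> N; rewrite mulr_ge0 ?g_ge0.
  - move=> N i v w vw; apply: gE => j.
    rewrite /cons_pt; case: unliftP => [j' ->|//].
    by rewrite /= /bump/= !add1n ltnS => /vw.
  - move=> v Av; have [f0 fle] := fP _ (A_cons _ _ Ax Av); split => //.
    apply: le_trans fle _; apply: lee_nneseries => [N _ _|N _].
      by rewrite lee_fin mulr_ge0// prodr_ge0.
    rewrite lee_fin big_ord_recl gord0 cons_ord0 mulrA.
    rewrite ler_wpM2l ?mulr_ge0 ?g_ge0// le_eqVlt; apply/orP; left.
    by apply/eqP/eq_bigr => i _; rewrite cons_lift.
rewrite /=.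
(* The inner integral is replaced by its bounding series before anything else: the terms of the
   series are measurable in [x], so that sum and integral can be exchanged. *)
apply: (@le_trans _ _ (\int[lebesgue_measure]_(x in A)
    \sum_(N <oo) ((c N * M' N)%:E * (g0 N x)%:E))%E).
  apply: le_integral_nonmeasurable => x Ax; last exact: step.
  by apply: iter_integral_ge0 => v Av; have [] := fP _ (A_cons _ _ Ax Av).
rewrite integral_nneseries//; last 2 first.
- move=> N; apply: emeasurable_funM => //; apply/measurable_EFinP; exact: mg.
- by move=> N x _; rewrite -EFinM lee_fin !mulr_ge0 ?g_ge0.
apply: lee_nneseries => [N _ _|N _].
  by apply: integral_ge0 => x _; rewrite -EFinM lee_fin !mulr_ge0 ?g_ge0.
rewrite ge0_integralZl//; last 3 first.
- by apply/measurable_EFinP; exact: mg.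
- by move=> x _; rewrite lee_fin g_ge0.
- by rewrite lee_fin mulr_ge0.
rewrite big_ord_recl -/(M' N) [in leRHS]mulrCA [in leRHS]mulrC.
rewrite !EFinM lee_wpmul2l//; last exact: gM.
by rewrite mule_ge0// lee_fin.
Qed.

End iter_integral_bounds.

(** * Tails and moments of [F] through shells *)

Section distribution_tail.
Context {R : realType} (F : cumulativeBounded (0 : R) (1 : R)).
Local Notation mu := (lebesgue_stieltjes_measure F).

Definition dist_shell (N : nat) : set R := [set x | N%:R <= `|x| < N.+1%:R].

Lemma measurable_dist_shell N : measurable (dist_shell N).
Proof.
rewrite (_ : dist_shell N = Num.norm @^-1` `[N%:R, N.+1%:R[%classic).
  by rewrite -[X in measurable X]setTI; exact: normr_measurable.
by apply/seteqP; split => x; rewrite /dist_shell /= in_itv.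
Qed.

Lemma trivIset_dist_shell : trivIset setT dist_shell.
Proof.
apply/trivIsetP => i j _ _ ij; apply/seteqP; split => // x [] /=.
move=> /truncn_def xi /truncn_def xj.
by move/eqP: ij; apply; rewrite -xi -xj.
Qed.

Lemma bigcup_dist_shell : \bigcup_N dist_shell N = setT.
Proof.
apply/seteqP; split => // x _.
by exists (Num.trunc `|x|) => //=; exact: truncn_itv.
Qed.

Definition shell_mass (N : nat) : R := fine (mu (dist_shell N)).

Lemma shell_massE N : (shell_mass N)%:E = mu (dist_shell N).
Proof. by rewrite fineK// fin_num_measure//; exact: measurable_dist_shell. Qed.

Lemma shell_mass_ge0 N : 0 <= shell_mass N.
Proof. exact/fine_ge0/measure_ge0. Qed.

(** Only shells with [s <= N + 1] can meet [A]. Keeping this condition as an indicator inside the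
    series lets it be bounded later by a product of one-coordinate indicators. *)
Lemma tail_le_series (A : set R) (s : R) : measurable A ->
  (forall x, A x -> s <= `|x|) ->
  (mu A <= \sum_(N <oo) (shell_mass N * (s <= N.+1%:R)%R%:R)%:E)%E.
Proof.
move=> mA As.
pose B N := if s <= N.+1%:R then dist_shell N else set0.
have mB N : measurable (B N).
  by rewrite /B; case: ifP => // _; exact: measurable_dist_shell.
apply: (@le_trans _ _ (\sum_(N <oo) mu (B N))%E).
  apply: measure_sigma_subadditive => // x Ax.
  have : (\bigcup_N dist_shell N) x by rewrite bigcup_dist_shell.
  move=> [N _ xN]; exists N => //; rewrite /B ifT//.
  by rewrite (le_trans (As _ Ax))// ltW//; case/andP: xN.
apply: lee_nneseries => [N _ _|N _]; first exact: measure_ge0.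
rewrite /B; case: ifP => _; last by rewrite measure0 mulr0.
by rewrite mulr1 shell_massE.
Qed.

Lemma cdf_massE (eta : R) : (F eta)%:E = mu `]-oo, eta].
Proof.
rewrite -(cdf_lebesgue_stieltjes_id F) /cdf/= /distribution /pushforward.
by rewrite preimage_id.
Qed.

Lemma response_prob_01 (y : bool) (eta : R) :
  0 <= F eta ^+ y * (1 - F eta) ^+ (~~ y) <= 1.
Proof.
have F_ge0 : 0 <= F eta by rewrite -lee_fin cdf_massE measure_ge0.
have F_le1 : F eta <= 1.
  by rewrite -lee_fin cdf_massE; apply: probability_le1.
case: y.
  have -> : F eta ^+ true * (1 - F eta) ^+ (~~ true) = F eta by rewrite mulr1.
  by rewrite F_ge0.
have -> : F eta ^+ false * (1 - F eta) ^+ (~~ false) = 1 - F eta.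
  by rewrite mul1r.
by rewrite subr_ge0 F_le1 lerBlDr lerDl.
Qed.

(** The response probability is the mass of a half-line, to the left of [eta] for a success and to
    its right for a failure. In both cases the points of the half-line have absolute value at least
    [(1 - 2 y) eta]. *)
Lemma response_prob_le_series (y : bool) (eta s : R) :
  s <= (1 - 2 * y%:R) * eta ->
  ((F eta ^+ y * (1 - F eta) ^+ (~~ y))%:E <=
   \sum_(N <oo) (shell_mass N * (s <= N.+1%:R)%R%:R)%:E)%E.
Proof.
case: y => s_le.
  have -> : F eta ^+ true * (1 - F eta) ^+ (~~ true) = F eta by rewrite mulr1.
  rewrite cdf_massE; apply: tail_le_series => // x /=; rewrite in_itv/= => x_eta.
  rewrite ler_normr; apply/orP; right; move: s_le => /=; lra.
have -> : F eta ^+ false * (1 - F eta) ^+ (~~ false) = 1 - F eta.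
  by rewrite mul1r.
rewrite EFinB cdf_massE.
have mI : measurable (`]-oo, eta] : set R) by [].
rewrite -(probability_setC mu mI) setCitvl.
apply: tail_le_series => // x /=; rewrite in_itv/= andbT => /ltW x_eta.
rewrite ler_normr; apply/orP; left; move: s_le => /=; lra.
Qed.

(** For [N >= 1], points of the shell satisfy [N + 1 <= 2 N <= 2 |x|]. The summand 1 in [h] takes
    care of the shell [N = 0] and is integrable because the measure is finite. *)
Lemma shell_moment_lty (alpha : R) : 0 <= alpha ->
  (\int[mu]_x ((`|x| `^ alpha)%:E) < +oo)%E ->
  (\sum_(N <oo) (shell_mass N * N.+1%:R `^ alpha)%:E < +oo)%E.
Proof.
move=> alpha_ge0 moment.
pose h (x : R) := ((1 + 2 `^ alpha * `|x| `^ alpha)%:E : \bar R).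
have mpow : measurable_fun setT (fun x : R => `|x| `^ alpha).
  by apply: (measurableT_comp (measurable_powR _)) => //; exact: normr_measurable.
have mh : measurable_fun setT h.
  apply/measurable_EFinP; apply: measurable_funD => //.
  exact: measurable_funM.
have h_ge0 x : (0 <= h x)%E by rewrite lee_fin addr_ge0// mulr_ge0// powR_ge0.
have : (\int[mu]_x h x < +oo)%E.
  rewrite /h; under eq_integral do rewrite EFinD EFinM.
  have pow_ge0 x : (0 <= (2 `^ alpha)%:E * (`|x| `^ alpha)%:E)%E.
    by rewrite -EFinM lee_fin mulr_ge0// powR_ge0.
  have mpow2 : measurable_fun setT
      (fun x : R => ((2 `^ alpha)%:E * (`|x| `^ alpha)%:E)%E).
    by apply: emeasurable_funM => //; exact/measurable_EFinP.
  rewrite ge0_integralD//.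
  apply: lte_add_pinfty.
    by rewrite integral_cst// mul1e ltey_eq fin_num_measure.
  have pow1_ge0 (x : R) : (0 <= (`|x| `^ alpha)%:E)%E by rewrite lee_fin powR_ge0.
  rewrite ge0_integralZl ?lee_fin ?powR_ge0//; last exact/measurable_EFinP.
  by rewrite lte_mul_pinfty// lee_fin powR_ge0.
apply: le_lt_trans.
rewrite -bigcup_dist_shell ge0_integral_bigcup//; last 3 first.
- exact: measurable_dist_shell.
- by rewrite bigcup_dist_shell.
- exact: trivIset_dist_shell.
apply: lee_nneseries => [N _ _|N _].
  by rewrite lee_fin mulr_ge0 ?powR_ge0 ?shell_mass_ge0.
rewrite mulrC EFinM shell_massE -integral_cst; last exact: measurable_dist_shell.
apply: le_integral_nonmeasurable => x; first by rewrite lee_fin powR_ge0.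
rewrite /dist_shell/= => /andP[Nx _]; rewrite lee_fin.
case: N Nx => [|N] Nx; first by rewrite powR1 lerDl mulr_ge0// powR_ge0.
rewrite -powRM//; apply: ler_wpDl => //.
apply: ge0_ler_powR => //; rewrite ?nnegrE ?mulr_ge0//.
apply: le_trans (ler_wpM2l _ Nx) => //.
by rewrite -natrM ler_nat; lia.
Qed.

End distribution_tail.

(** * One-dimensional integrals: intervals, Gaussians and powers *)

Section one_dimensional_integrals.
Context {R : realType}.
Local Notation leb := (@lebesgue_measure R).

Lemma integral_indic_ball_le (s rho : R) : 0 <= rho ->
  (\int[leb]_x ((`|x + s| <= rho)%R%:R)%:E <= (2 * rho)%:E)%E.
Proof.
move=> rho_ge0.
have -> : (fun x : R => ((`|x + s| <= rho)%R%:R)%:E) =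
    (EFin \o \1_(`[- rho - s, rho - s]) : R -> \bar R).
  apply/funext => x /=; rewrite indicE; congr ((nat_of_bool _)%:R%:E).
  rewrite ler_norml; apply/idP/idP.
    by move=> /andP[h1 h2]; rewrite inE/= in_itv/=; apply/andP; split; lra.
  by rewrite inE/= in_itv/= => /andP[h1 h2]; apply/andP; split; lra.
rewrite integral_indic//= setIT lebesgue_measure_itv/= lte_fin.
case: ifP => _; last by rewrite lee_fin mulr_ge0.
by rewrite -EFinB lee_fin; lra.
Qed.

(** Up to the factor [normal_peak], the integrand is the normal density with standard deviation
    [sg], the inverse square root of [tau]. *)
Lemma integral_gauss_le (tau : R) : 0 < tau ->
  (\int[leb]_x (expR (- tau / 2 * x ^+ 2))%:E <=
    (Num.sqrt (2 * pi) * tau `^ (- 2^-1))%:E)%E.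
Proof.
move=> tau_gt0.
pose sg := (Num.sqrt tau)^-1.
have sg0 : sg != 0 by rewrite invr_eq0 sqrtr_eq0 -ltNge.
have sg2 : sg ^+ 2 = tau^-1 by rewrite exprVn sqr_sqrtr// ltW.
have e x : (expR (- tau / 2 * x ^+ 2))%:E =
    ((normal_peak sg)^-1%:E * (normal_pdf 0 sg x)%:E)%E.
  rewrite normal_pdfE//= -EFinM mulKf; last by rewrite gt_eqF// normal_peak_gt0.
  rewrite /normal_fun subr0 sg2; congr ((expR _)%:E).
  by field; rewrite gt_eqF.
under eq_integral do rewrite e.
have mpdf : measurable_fun setT (EFin \o normal_pdf (0 : R) sg).
  by apply/measurable_EFinP; exact: measurable_normal_pdf.
have pdf_ge0 (x : R) : (0 <= (normal_pdf 0 sg x)%:E)%E.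
  by rewrite lee_fin normal_pdf_ge0.
rewrite ge0_integralZl ?lee_fin ?invr_ge0 ?normal_peak_ge0//.
rewrite integral_normal_pdf mule1 lee_fin /normal_peak invrK sg2.
rewrite powRN powR12_sqrt ?(ltW tau_gt0)//.
rewrite -sqrtrV ?(ltW tau_gt0)// -sqrtrM ?mulr_ge0 ?pi_ge0//.
rewrite le_eqVlt; apply/orP; left; apply/eqP; congr Num.sqrt.
by rewrite -mulr_natr; lra.
Qed.

Lemma integral_powR_segment (s u v : R) : s != 0 -> 0 < u -> u < v ->
  (\int[leb]_(x in `[u, v]) (x `^ (s - 1))%:E = ((v `^ s - u `^ s) / s)%:E)%E.
Proof.
move=> s0 u_gt0 uv.
have dF (x : R) : 0 < x -> is_derive x 1 (fun x : R => s^-1 * x `^ s) (x `^ (s - 1)).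
  move=> x_gt0.
  have h := @is_deriveZ _ _ _ _ s^-1 _ _ _ (is_derive1_powR s x_gt0).
  apply: is_derive_eq h _.
  by rewrite /GRing.scale/= mulKf.
have cF (x : R) : 0 < x -> {for x, continuous (fun x : R => s^-1 * x `^ s)}.
  by move=> /dF h; apply/differentiable_continuous/derivable1_diffP.
have dpow (x a : R) : 0 < x -> derivable (fun x : R => x `^ a) x 1.
  by move=> x_gt0; apply: derivable_powR; rewrite in_itv/= andbT.
rewrite (@continuous_FTC2 _ _ (fun x => s^-1 * x `^ s))//.
- by rewrite -EFinB -mulrBr mulrC.
- apply: derivable_within_continuous => x; rewrite in_itv/= => /andP[ux _].
  exact/dpow/(lt_le_trans u_gt0).
- split.
  + by move=> x; rewrite in_itv/= => /andP[/(lt_trans u_gt0) /dF].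
  + exact: cvg_at_right_filter (cF _ u_gt0).
  + exact: cvg_at_left_filter (cF _ (lt_trans u_gt0 uv)).
- move=> x; rewrite in_itv/= => /andP[ux _].
  have h := dF x (lt_trans u_gt0 ux).
  by rewrite derive1E derive_val.
Qed.

(** Monotone convergence, in the form that passes from compact segments to an interval reaching 0 or
    infinity. *)
Lemma ge0_integral_bigcup_le (D : (set R)^nat) (f : R -> \bar R) (B : \bar R) :
  {homo D : n m / (n <= m)%N >-> (n <= m)%O} -> (forall n, measurable (D n)) ->
  measurable_fun (\bigcup_n D n) f -> (forall x, (0 <= f x)%E) ->
  (forall n, (\int[leb]_(x in D n) f x <= B)%E) ->
  (\int[leb]_(x in \bigcup_n D n) f x <= B)%E.
Proof.
move=> ndD mD mf f_ge0 fB.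
have mfD n : measurable_fun (D n) f.
  by apply: measurable_funS mf; [exact: bigcup_measurable|exact: bigcup_sup].
have h : (\int[leb]_(x in D n) f x)%E @[n --> \oo] -->
    (\int[leb]_(x in \bigcup_n D n) f x)%E.
  by apply: ge0_nondecreasing_set_cvg_integral => //.
rewrite -(cvg_lim _ h)//; apply: lime_le; first by apply/cvg_ex; eexists; exact: h.
by near=> n; exact: fB.
Unshelve. all: by end_near. Qed.

Let mpowR (D : set R) (s : R) : measurable_fun D (fun x : R => (x `^ s)%:E).
Proof. by apply/measurable_EFinP; apply: measurable_funTS; exact: measurable_powR. Qed.

Lemma integral_powR_near0_le (s c : R) : 0 < s -> 0 < c ->
  (\int[leb]_(x in `]0%R, c]) (x `^ (s - 1))%:E <= (c `^ s / s)%:E)%E.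
Proof.
move=> s_gt0 c_gt0.
(* The denominator [n + 2] keeps the left end strictly below [c], as the formula on a segment
   requires. *)
have -> : (`]0, c]%classic : set R) = \bigcup_n `[c / n.+2%:R, c]%classic.
  apply/seteqP; split => x /=.
    rewrite in_itv/= => /andP[x_gt0 xc].
    exists (Num.trunc (c / x)) => //=; rewrite in_itv/= xc andbT.
    rewrite ler_pdivrMr// mulrC -ler_pdivrMr//.
    have /andP[_ /ltW/le_trans] := truncn_itv (divr_ge0 (ltW c_gt0) (ltW x_gt0)).
    by apply; rewrite ler_nat.
  move=> [n _] /=; rewrite !in_itv/= => /andP[cx ->]; rewrite andbT.
  by rewrite (lt_le_trans _ cx)// divr_gt0.
apply: ge0_integral_bigcup_le => //.
- move=> n m nm; apply/subsetPset => x /=; rewrite !in_itv/= => /andP[cx ->].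
  rewrite andbT (le_trans _ cx)// ler_pM2l// lef_pV2 ?posrE// ler_nat.
  by rewrite !ltnS.
- by move=> x; rewrite lee_fin powR_ge0.
- move=> n; rewrite integral_powR_segment ?gt_eqF ?divr_gt0//; last first.
    by rewrite ltr_pdivrMr// ltr_pMr// ltr1n.
  by rewrite lee_fin ler_pM2r ?invr_gt0// gerBl powR_ge0.
Qed.

Lemma integral_powR_neary_le (s c : R) : s < 0 -> 0 < c ->
  (\int[leb]_(x in `]c, +oo[) (x `^ (s - 1))%:E <= (c `^ s / - s)%:E)%E.
Proof.
move=> s_lt0 c_gt0.
have -> : (`]c, +oo[%classic : set R) = \bigcup_n `]c, c + n%:R]%classic.
  exact: itv_bndy_bigcup_BRight.
apply: ge0_integral_bigcup_le => //.
- move=> n m nm; apply/subsetPset => x /=; rewrite !in_itv/= => /andP[-> xc]/=.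
  by rewrite (le_trans xc)// lerD2l ler_nat.
- by move=> x; rewrite lee_fin powR_ge0.
- move=> n.
  (* The enlarged segment is nondegenerate even for [n = 0]. *)
  have sub : `]c, c + n%:R]%classic `<=` (`[c, c + n.+1%:R]%classic : set R).
    move=> x /=; rewrite !in_itv/= => /andP[/ltW -> xc]/=.
    by rewrite (le_trans xc)// lerD2l ler_nat.
  have pow_ge0 (x : R) : (0 <= (x `^ (s - 1))%:E)%E by rewrite lee_fin powR_ge0.
  apply: (@le_trans _ _ (\int[leb]_(x in `[c, (c + n.+1%:R)%R]) (x `^ (s - 1))%:E)%E).
    by apply: ge0_subset_integral => //; exact: mpowR.
  rewrite integral_powR_segment ?lt_eqF ?ltrDl// lee_fin.
  rewrite ler_pdivlMr ?oppr_gt0// mulrN divfK ?lt_eqF//.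
  by have := powR_ge0 (c + n.+1%:R) s; lra.
Qed.

(** The exponent [s - 1] is integrable at 0 and [a - 1] at infinity. The cut [c] is left free
    because it will be chosen as a function of the radius. *)
Lemma integral_gt0_powR_dominated_le (h : R -> R) (s a c B1 B2 : R) :
  0 < s -> a < 0 -> 0 < c -> 0 <= B1 -> 0 <= B2 ->
  (forall x, 0 <= h x) -> measurable_fun setT h ->
  (forall x, 0 < x -> x <= c -> h x <= B1 * x `^ (s - 1)) ->
  (forall x, c < x -> h x <= B2 * x `^ (a - 1)) ->
  (\int[leb]_(x in [set x | (0 < x)%R]) (h x)%:E <=
    (B1 * (c `^ s / s) + B2 * (c `^ a / - a))%:E)%E.
Proof.
move=> s_gt0 a_lt0 c_gt0 B1_ge0 B2_ge0 h_ge0 mh hB1 hB2.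
have -> : [set x : R | 0 < x] = `]0%R, c] `|` `]c, +oo[.
  apply/seteqP; split => x /=; rewrite !in_itv/= andbT.
    by move=> ->; case: leP; [left|right].
  by move=> [/andP[]//|]; exact: lt_trans.
have disj : [disjoint `]0%R, c]%classic & `]c, +oo[%classic : set R].
  apply/disj_setPS => x /= []; rewrite !in_itv/= andbT => /andP[_ xc].
  by rewrite ltNge xc.
rewrite ge0_integral_setU//; last 2 first.
- by apply/measurable_EFinP; exact: measurable_funTS.
- by move=> x _; rewrite lee_fin.
have bound (D : set R) (B e K : R) : measurable D -> 0 <= B ->
    (forall x, D x -> h x <= B * x `^ e) ->
    (\int[leb]_(x in D) (x `^ e)%:E <= K%:E)%E ->
    (\int[leb]_(x in D) (h x)%:E <= (B * K)%:E)%E.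
  move=> mD B_ge0 hB intK.
  have pow_ge0 (x : R) : (0 <= (x `^ e)%:E)%E by rewrite lee_fin powR_ge0.
  apply: (@le_trans _ _ (\int[leb]_(x in D) (B%:E * (x `^ e)%:E))%E).
    by apply: le_integral_nonmeasurable => x Dx;
      [rewrite lee_fin|rewrite -EFinM lee_fin hB].
  rewrite ge0_integralZl ?lee_fin//; last exact: mpowR.
  by rewrite EFinM lee_wpmul2l// lee_fin.
rewrite EFinD; apply: leeD.
- apply: (bound _ B1 (s - 1)) => //; last exact: integral_powR_near0_le.
  by move=> x; rewrite /= in_itv/= => /andP[x0 xc]; exact: hB1.
- apply: (bound _ B2 (a - 1)) => //; last exact: integral_powR_neary_le.
  by move=> x; rewrite /= in_itv/= andbT; exact: hB2.
Qed.

End one_dimensional_integrals.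

(** * Integration over one precision parameter *)

Lemma gt0_powRD (R : realType) (x r s : R) : 0 < x -> x `^ (r + s) = x `^ r * x `^ s.
Proof. by move=> x_gt0; rewrite powRD// (gt_eqF x_gt0) implybT. Qed.

(** A single term of degree [n + 2 >= s + 1] of the exponential series already outgrows the power.
    The exponent is written [-1 - 1] to fit the form [a - 1] of the domination lemma. *)
Lemma powR_expR_le (R : realType) (s b : R) : 0 < b ->
  exists2 K, 0 <= K & forall x, 1 <= x ->
    x `^ (s - 1) * expR (- x * b) <= K * x `^ (-1 - 1).
Proof.
move=> b_gt0.
pose n := Num.trunc `|s|.
have sn : s + 1 <= n.+2%:R.
  have /andP[_ sn] := truncn_itv (normr_ge0 s).
  rewrite -natr1 lerD2r (le_trans (ler_norm s))//; exact: ltW.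
exists (n.+2`!%:R / b ^+ n.+2).
  by rewrite divr_ge0// exprn_ge0// ltW.
move=> x x1.
have x_gt0 : 0 < x by rewrite (lt_le_trans ltr01).
have -> : x `^ (s - 1) = x `^ (s + 1) * x `^ (-1 - 1).
  by rewrite -gt0_powRD//; congr powR; lra.
rewrite mulrAC ler_wpM2r ?powR_ge0//.
rewrite mulNr expRN ler_pdivrMr ?expR_gt0//.
apply: (@le_trans _ _ (x ^+ n.+2)).
  by rewrite -powR_mulrn ?(ltW x_gt0)//; exact: ler_powR.
have := @expR_ge1Dxn R (x * b) n.+1 (mulr_ge0 (ltW x_gt0) (ltW b_gt0)).
rewrite exprMn => h.
have {}h : x ^+ n.+2 * b ^+ n.+2 / n.+2`!%:R <= expR (x * b) by move: h; lra.
have f_gt0 : 0 < n.+2`!%:R :> R by rewrite ltr0n fact_gt0.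
by rewrite [leRHS]mulrAC ler_pdivlMr ?exprn_gt0// [leRHS]mulrC -ler_pdivrMr.
Qed.

(* [C * tau `^ (- 2^-1)] stands for the Gaussian integral over one random effect
   and [2 * rho] for the length of the interval to which it is confined; for
   [b = 0] the first bound is needed at infinity and the second one at 0. *)
Definition precision_factor (R : realType) (q : nat) (a b C rho tau : R) : R :=
  tau `^ (q%:R / 2 + a - 1) * expR (- tau * b) * (C * tau `^ (- 2^-1)) *
  Num.min (2 * rho) (C * tau `^ (- 2^-1)) ^+ q.-1.

Section precision_integral.
Context {R : realType}.
Variables (q : nat) (a b C : R).
Hypotheses (q_gt0 : (0 < q)%N) (C_gt0 : 0 < C).

Let m := q.-1.
(** [s - 1] is the exponent of [tau] once the prior power is merged with one Gaussian factor;
    [0 < s] is (B2) divided by two. *)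
Let s : R := m%:R / 2 + a.

Let natr_q : q%:R = m%:R + 1 :> R.
Proof. by rewrite natr1 prednK. Qed.

Lemma precision_factor_ge0 rho tau : 0 <= rho ->
  0 <= precision_factor q a b C rho tau.
Proof.
move=> rho_ge0; have C_ge0 := ltW C_gt0.
by rewrite !mulr_ge0 ?powR_ge0 ?expR_ge0// exprn_ge0// le_min !mulr_ge0// powR_ge0.
Qed.

Lemma measurable_precision_factor rho :
  measurable_fun setT (precision_factor q a b C rho).
Proof.
have mp e : measurable_fun setT (fun tau : R => tau `^ e) by exact: measurable_powR.
have mg : measurable_fun setT (fun tau : R => C * tau `^ (- 2^-1)).
  exact: measurable_funM.
apply: measurable_funM; last first.
  by apply: measurable_funX; exact: measurable_minr.
apply: measurable_funM => //; apply: measurable_funM => //.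
apply: measurableT_comp => //; exact: measurable_funM.
Qed.

Let powR_split tau : 0 < tau ->
  tau `^ (q%:R / 2 + a - 1) * tau `^ (- 2^-1) = tau `^ (s - 1).
Proof.
move=> tau_gt0; rewrite -gt0_powRD//.
by congr powR; rewrite /s natr_q; lra.
Qed.

Let factor_le_radius rho tau : 0 <= rho -> 0 < tau ->
  precision_factor q a b C rho tau <=
  C * (2 * rho) ^+ m * (tau `^ (s - 1) * expR (- tau * b)).
Proof.
move=> rho_ge0 tau_gt0; have C_ge0 := ltW C_gt0.
rewrite -powR_split// /precision_factor.
set A := tau `^ _; set E := expR _; set B := tau `^ _.
have -> : C * (2 * rho) ^+ m * (A * B * E) = A * E * (C * B) * (2 * rho) ^+ m by ring.
rewrite ler_wpM2l ?mulr_ge0 ?powR_ge0 ?expR_ge0//.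
by apply: lerXn2r;
  rewrite ?nnegrE ?le_min ?ge_min ?lexx ?mulr_ge0 ?powR_ge0.
Qed.

(** The exponential already gives convergence at infinity, so the minimum can be replaced by
    [2 * rho] everywhere. The radius then enters only through the power [m], and the cut is at 1. *)
Lemma precision_integral_le_exp : 0 < b -> 0 < s -> exists D, forall rho, 0 < rho ->
  (\int[lebesgue_measure]_(tau in [set tau | (0 < tau)%R])
     (precision_factor q a b C rho tau)%:E <= (D * rho ^+ m)%:E)%E.
Proof.
move=> b_gt0 s_gt0; have [K K_ge0 hK] := powR_expR_le s b_gt0.
exists (C * 2 ^+ m * (s^-1 + K)) => rho rho_gt0.
have rho_ge0 := ltW rho_gt0; have C_ge0 := ltW C_gt0.
pose B := C * (2 * rho) ^+ m.
have B_ge0 : 0 <= B by rewrite mulr_ge0// exprn_ge0// mulr_ge0.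
have BK_ge0 : 0 <= B * K by exact: mulr_ge0.
have near0 tau : 0 < tau -> tau <= 1 ->
    precision_factor q a b C rho tau <= B * tau `^ (s - 1).
  move=> tau_gt0 _; apply: le_trans (factor_le_radius rho_ge0 tau_gt0) _.
  rewrite ler_wpM2l// ler_piMr ?powR_ge0// -expR0 ler_expR.
  by rewrite mulNr oppr_le0 mulr_ge0 ?ltW.
have neary tau : 1 < tau ->
    precision_factor q a b C rho tau <= B * K * tau `^ (-1 - 1).
  move=> tau_gt1; have tau_gt0 : 0 < tau by exact: lt_trans tau_gt1.
  apply: le_trans (factor_le_radius rho_ge0 tau_gt0) _.
  by rewrite -[leRHS]mulrA ler_wpM2l// hK// ltW.
apply: le_trans (integral_gt0_powR_dominated_le s_gt0 (ltrN10 R) ltr01 B_ge0 BK_ge0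
  (fun tau => precision_factor_ge0 tau rho_ge0) (measurable_precision_factor rho)
  near0 neary) _.
rewrite !powR1 lee_fin /B exprMn opprK le_eqVlt; apply/orP; left; apply/eqP.
by field; rewrite gt_eqF.
Qed.

(** The cut [rho ^ (-2)] is where both arguments of the minimum are of order [rho]. Below it the
    interval length is used, giving [rho ^ m * rho ^ (-2 s)]; above it the Gaussian bound leaves
    [tau ^ (a - 1)], integrable at infinity since [a < 0]. Both parts scale as [rho ^ (-2 a)]. *)
Lemma precision_integral_le_powR : b = 0 -> a < 0 -> 0 < s ->
  exists D, forall rho, 0 < rho ->
  (\int[lebesgue_measure]_(tau in [set tau | (0 < tau)%R])
     (precision_factor q a b C rho tau)%:E <= (D * rho `^ (- 2 * a))%:E)%E.
Proof.
move=> b0 a_lt0 s_gt0.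
exists (C * 2 ^+ m / s + C ^+ m.+1 / - a) => rho rho_gt0.
have rho_ge0 := ltW rho_gt0; have C_ge0 := ltW C_gt0.
pose B := C * (2 * rho) ^+ m.
have B_ge0 : 0 <= B by rewrite mulr_ge0// exprn_ge0// mulr_ge0.
have c_gt0 : 0 < rho `^ (- 2) by rewrite powR_gt0.
have near0 tau : 0 < tau -> tau <= rho `^ (- 2) ->
    precision_factor q a b C rho tau <= B * tau `^ (s - 1).
  move=> tau_gt0 _; apply: le_trans (factor_le_radius rho_ge0 tau_gt0) _.
  by rewrite b0 mulr0 expR0 mulr1.
have neary tau : rho `^ (- 2) < tau ->
    precision_factor q a b C rho tau <= C ^+ m.+1 * tau `^ (a - 1).
  move=> tau_gt; have tau_gt0 : 0 < tau by exact: lt_trans tau_gt.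
  have tau_ge0 := ltW tau_gt0.
  have -> : tau `^ (a - 1) = tau `^ (s - 1) * (tau `^ (- 2^-1)) ^+ m.
    rewrite -powR_mulrn ?powR_ge0// -powRrM -gt0_powRD//.
    by congr powR; rewrite /s; lra.
  rewrite -powR_split// /precision_factor b0 mulr0 expR0 mulr1.
  set A := tau `^ _; set G := tau `^ _.
  have -> : C ^+ m.+1 * (A * G * G ^+ m) = A * (C * G) * (C * G) ^+ m.
    by rewrite exprS exprMn; ring.
  rewrite ler_wpM2l ?mulr_ge0 ?powR_ge0//.
  by apply: lerXn2r;
    rewrite ?nnegrE ?le_min ?ge_min ?lexx ?orbT ?mulr_ge0 ?powR_ge0.
apply: le_trans (integral_gt0_powR_dominated_le s_gt0 a_lt0 c_gt0 B_ge0
  (exprn_ge0 _ C_ge0) (fun tau => precision_factor_ge0 tau rho_ge0)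
  (measurable_precision_factor rho) near0 neary) _.
rewrite lee_fin -!powRrM /B exprMn.
have -> : C * (2 ^+ m * rho ^+ m) * (rho `^ (- 2 * s) / s) =
    C * 2 ^+ m / s * rho `^ (- 2 * a).
  have -> : rho `^ (- 2 * a) = rho ^+ m * rho `^ (- 2 * s).
    rewrite -powR_mulrn// -gt0_powRD//.
    by congr powR; rewrite /s; lra.
  by field; rewrite gt_eqF.
by rewrite le_eqVlt; apply/orP; left; apply/eqP; field; rewrite lt_eqF ?gt_eqF.
Qed.

End precision_integral.

Lemma precision_integral_le (R : realType) (q : nat) (a b C : R) :
  (0 < q)%N -> 0 < C -> a < 0 /\ b = 0 \/ 0 < b -> 0 < 2 * a + q%:R - 1 ->
  exists D, forall rho, 0 < rho ->
  (\int[lebesgue_measure]_(tau in [set tau | (0 < tau)%R])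
     (precision_factor q a b C rho tau)%:E <=
   (D * rho `^ (- 2 * a * (b == 0)%R%:R + (q%:R - 1) * (0 < b)%R%:R))%:E)%E.
Proof.
move=> q_gt0 C_gt0 hab aq.
have natr_q : q%:R - 1 = q.-1%:R :> R.
  by rewrite -[in LHS](prednK q_gt0) -natr1 addrK.
have s_gt0 : 0 < q.-1%:R / 2 + a by rewrite -natr_q; lra.
case: hab => [[a_lt0 b0]|b_gt0].
  have [D hD] := precision_integral_le_powR q_gt0 C_gt0 b0 a_lt0 s_gt0.
  by exists D => rho /hD; rewrite b0 eqxx ltxx mulr1 mulr0 addr0.
have [D hD] := precision_integral_le_exp q_gt0 C_gt0 b_gt0 s_gt0.
exists D => rho rho_gt0; rewrite gt_eqF// b_gt0 mulr0 mulr1 add0r.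
rewrite natr_q powR_mulrn ?(ltW rho_gt0)//; exact: hD.
Qed.

(** * Domination and integration of the posterior *)

Section posterior.
Context {R : realType} (F : cumulativeBounded (0 : R) (1 : R)).
Variables (n p r : nat) (qj : 'I_r -> nat).
Variables (X : 'M[R]_(n, p)) (lev : forall j : 'I_r, 'I_n -> 'I_(qj j)).
Variables (y : 'I_n -> bool) (a b : 'I_r -> R).
Hypothesis q_gt0 : forall j, (0 < qj j)%N.

Local Notation q := (\sum_(j < r) qj j)%N.
Local Notation base v j := (v (tagnat.Rank j (Ordinal (q_gt0 j)))).

Definition posterior_integrand (tau : 'I_r -> R) (uf : 'I_q -> R) (bf : 'I_p -> R) : R :=
  let beta : 'cV[R]_p := \col_k bf k in
  let u : 'cV[R]_q := \col_k uf k in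
  let eta : 'cV[R]_n := (X *m beta + Zmat lev *m u)%R in
  (\prod_(i < n) (F (eta i ord0) ^+ y i * (1 - F (eta i ord0)) ^+ (~~ y i)))
  * \prod_(j < r)
      (tau j `^ ((qj j)%:R / 2 + a j - 1)
       * expR (- tau j * (b j + 2^-1 *
           ((submxcol u j)^T *m submxcol u j) ord0 ord0))).

Definition prior_weight (tau : 'I_r -> R) : R :=
  \prod_(j < r) (tau j `^ ((qj j)%:R / 2 + a j - 1) * expR (- tau j * b j)).

Definition intercept_ball (rho : R) (uf : 'I_q -> R) (k : 'I_p) (x : R) : R :=
  (`|x + (if val k == 0%N then \sum_j base uf j else 0)| <= rho)%R%:R.

(** The reference coordinate of the same effect is read from [v]. Its column precedes [l] unless [l]
    is itself the reference, so it is already fixed when [x] is integrated. *)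
Definition effect_factor (tau : 'I_r -> R) (rho : R) (l : 'I_q) (v : 'I_q -> R)
    (x : R) : R :=
  expR (- tau (tagnat.sig1 l) / 2 * x ^+ 2) *
  (if val (tagnat.sig2 l) == 0%N then 1
   else (`|x - base v (tagnat.sig1 l)| <= rho)%R%:R).

Lemma prod_tagnat (H : forall j : 'I_r, 'I_(qj j) -> R) :
  \prod_(l < q) H (tagnat.sig1 l) (tagnat.sig2 l) = \prod_j \prod_(k < qj j) H j k.
Proof.
rewrite [RHS]sig_big_dep/=.
by rewrite (reindex tagnat.sig)//=; exact/onW_bij/tagnat.sig_bij.
Qed.

Lemma prior_density_prodE (tau : 'I_r -> R) (uf : 'I_q -> R) :
  \prod_(j < r)
      (tau j `^ ((qj j)%:R / 2 + a j - 1)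
       * expR (- tau j * (b j + 2^-1 *
           ((submxcol (\col_k uf k : 'cV[R]_q) j)^T *m
             submxcol (\col_k uf k : 'cV[R]_q) j) ord0 ord0))) =
  prior_weight tau * \prod_(l < q) expR (- tau (tagnat.sig1 l) / 2 * uf l ^+ 2).
Proof.
have -> : \prod_(l < q) expR (- tau (tagnat.sig1 l) / 2 * uf l ^+ 2) =
    \prod_(j < r) \prod_(k < qj j) expR (- tau j / 2 * uf (tagnat.Rank j k) ^+ 2).
  rewrite -prod_tagnat; apply: eq_bigr => l _.
  by rewrite tagnat.sig2K.
rewrite -big_split/=; apply: eq_bigr => j _.
rewrite -expR_sum -mulrA -expRD; congr (_ * expR _).
rewrite mulrDr; congr (_ + _); rewrite mulrA mxE mulr_sumr.
by apply: eq_bigr => k _; rewrite !mxE expr2.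
Qed.

Lemma posterior_integrand_ge0 tau uf bf : 0 <= posterior_integrand tau uf bf.
Proof.
apply: mulr_ge0; apply: prodr_ge0 => i _.
  have F_ge0 t : 0 <= F t ^+ y i * (1 - F t) ^+ (~~ y i).
    by case/andP: (response_prob_01 F (y i) t).
  exact: F_ge0.
by rewrite mulr_ge0 ?powR_ge0 ?expR_ge0.
Qed.

Lemma prior_weight_ge0 tau : 0 <= prior_weight tau.
Proof. by apply: prodr_ge0 => j _; rewrite mulr_ge0 ?powR_ge0 ?expR_ge0. Qed.

Lemma effect_factor_ge0 tau rho l v x : 0 <= effect_factor tau rho l v x.
Proof. by rewrite mulr_ge0 ?expR_ge0//; case: ifP. Qed.

(** All likelihood factors are at most 1, so only that of the dominating observation is kept and
    expanded over shells. A shell contributes only if the signed predictor is at most [N + 1], and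
    then every coordinate lies in its ball of radius [K * (N + 1)]. *)
Lemma posterior_integrand_le_series (K : R) tau uf bf : 0 < K ->
  (exists i,
    let s := K * (cy R y i *
      (X *m (\col_k bf k) + Zmat lev *m (\col_k uf k)) i ord0) in
    (forall k : 'I_p, `|bf k + (if val k == 0%N then \sum_j base uf j else 0)| <= s) /\
    (forall j (k : 'I_(qj j)), val k != 0%N ->
       `|uf (tagnat.Rank j k) - base uf j| <= s)) ->
  ((posterior_integrand tau uf bf)%:E <=
   \sum_(N <oo) (shell_mass F N * (prior_weight tau *
       \prod_(l < q) effect_factor tau (K * N.+1%:R) l uf (uf l)) *
     \prod_(k < p) intercept_ball (K * N.+1%:R) uf k (bf k))%:E)%E.
Proof.
move=> K_gt0 [i [hbeta hu]].
pose eta := X *m (\col_k bf k) + Zmat lev *m (\col_k uf k) : 'cV[R]_n.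
rewrite -/eta in hbeta hu.
rewrite /posterior_integrand/= -/eta prior_density_prodE.
set lik := \prod_(i < n) _; set prior := prior_weight tau * _.
have prior_ge0 : 0 <= prior.
  apply: mulr_ge0; first exact: prior_weight_ge0.
  by apply: prodr_ge0 => l _; exact: expR_ge0.
pose fi : R := F (eta i ord0) ^+ y i * (1 - F (eta i ord0)) ^+ (~~ y i).
have lik_le : lik <= fi.
  rewrite /lik (bigD1 i)//= -/fi ler_piMr//.
    by have /andP[] := response_prob_01 F (y i) (eta i ord0).
  by apply: prodr_ile1 => j _; exact: response_prob_01.
apply: (@le_trans _ _ (prior%:E * fi%:E)%E).
  by rewrite -EFinM lee_fin mulrC ler_wpM2l.
(* The threshold is the signed predictor of observation [i] itself. *)
have fi_le := @response_prob_le_series R F (y i) (eta i ord0) _ (lexx _).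
apply: le_trans (lee_wpmul2l _ fi_le) _; first by rewrite lee_fin.
rewrite -nneseriesZl; last first.
  by move=> N _; rewrite lee_fin; apply: mulr_ge0 => //; exact: shell_mass_ge0.
apply: lee_nneseries => [N _ _|N _].
  rewrite -EFinM lee_fin; apply: mulr_ge0 => //; apply: mulr_ge0 => //.
  exact: shell_mass_ge0.
rewrite -EFinM lee_fin -[leRHS]mulrA mulrCA ler_wpM2l ?shell_mass_ge0//.
have rhs_ge0 : 0 <= prior_weight tau *
    \prod_(l < q) effect_factor tau (K * N.+1%:R) l uf (uf l) *
    \prod_(k < p) intercept_ball (K * N.+1%:R) uf k (bf k).
  apply: mulr_ge0; last by apply: prodr_ge0.
  apply: mulr_ge0; first exact: prior_weight_ge0.
  by apply: prodr_ge0 => l _; exact: effect_factor_ge0.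
case: (leP _ N.+1%:R) => [sN|_]; last by rewrite mulr0.
have le_rho : K * (cy R y i * eta i ord0) <= K * N.+1%:R by rewrite ler_pM2l.
rewrite mulr1 [X in _ <= _ * X]big1 => [|k _]; last first.
  by rewrite /intercept_ball (le_trans (hbeta k)).
rewrite mulr1 /prior le_eqVlt; apply/orP; left; apply/eqP; congr (_ * _).
apply: eq_bigr => l _; rewrite /effect_factor.
case: ifPn => l0; first by rewrite mulr1.
have := hu _ _ l0; rewrite tagnat.sig2K => ul.
by rewrite (le_trans ul) ?mulr1.
Qed.

Let gauss_const : R := Num.sqrt (2 * pi).

Let gauss_const_gt0 : 0 < gauss_const.
Proof. by rewrite sqrtr_gt0 mulr_gt0// pi_gt0. Qed.

Definition effect_mass (tau : 'I_r -> R) (rho : R) (l : 'I_q) : R :=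
  let g := gauss_const * tau (tagnat.sig1 l) `^ (- 2^-1) in
  if val (tagnat.sig2 l) == 0%N then g else Num.min (2 * rho) g.

Lemma measurable_effect_factor tau rho l v :
  measurable_fun setT (effect_factor tau rho l v).
Proof.
apply: measurable_funM.
  by apply: measurableT_comp => //; exact: measurable_funM.
case: (_ == 0%N) => //.
apply: measurableT_comp => //; apply: measurable_fun_ler => //.
apply: measurableT_comp => //; exact: measurable_funB.
Qed.

(** The Gaussian and the indicator are both at most 1, so either may be dropped; the one that is
    kept is whichever attains the minimum. *)
Lemma integral_effect_factor_le tau rho l v : 0 < tau (tagnat.sig1 l) -> 0 <= rho ->
  (\int[lebesgue_measure]_x (effect_factor tau rho l v x)%:E <=
   (effect_mass tau rho l)%:E)%E.
Proof.
move=> tau_gt0 rho_ge0; rewrite /effect_factor /effect_mass.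
have gauss_ge0 (x : R) : 0 <= expR (- tau (tagnat.sig1 l) / 2 * x ^+ 2).
  exact: expR_ge0.
case: (_ == 0%N).
  under eq_integral do rewrite mulr1.
  exact: integral_gauss_le.
rewrite /Num.min; case: ifP => _.
  apply: le_trans (integral_indic_ball_le (- base v (tagnat.sig1 l)) rho_ge0).
  apply: le_integral_nonmeasurable => x _; rewrite lee_fin; first exact: mulr_ge0.
  rewrite ler_piMl// -expR0 ler_expR 2!mulNr oppr_le0.
  by rewrite mulr_ge0 ?sqr_ge0 ?divr_ge0 ?(ltW tau_gt0).
apply: le_trans (integral_gauss_le tau_gt0).
apply: le_integral_nonmeasurable => x _; rewrite lee_fin; first exact: mulr_ge0.
by rewrite ler_piMr// lern1 leq_b1.
Qed.

(** Each effect has one reference column, contributing a pure Gaussian integral, and [qj j - 1]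
    further columns contributing the minimum. *)
Lemma prior_effect_massE tau rho :
  prior_weight tau * \prod_(l < q) effect_mass tau rho l =
  \prod_(j < r) precision_factor (qj j) (a j) (b j) gauss_const rho (tau j).
Proof.
pose H j (k : 'I_(qj j)) := let g := gauss_const * tau j `^ (- 2^-1) in
  if val k == 0%N then g else Num.min (2 * rho) g.
rewrite (prod_tagnat H) -big_split/=; apply: eq_bigr => j _.
rewrite /precision_factor -[RHS]mulrA; congr (_ * _).
rewrite /H; case: (qj j) (q_gt0 j) => // m _.
rewrite big_ord_recl/=; congr (_ * _).
by rewrite prodr_const card_ord.
Qed.

Hypothesis p_gt0 : (0 < p)%N.
Hypothesis X1 : forall (i : 'I_n) (k : 'I_p), val k = 0%N -> X i k = 1.
Hypothesis rkW : \rank (Wt X lev) = (p + \sum_(j < r) (qj j).-1)%N.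
Hypothesis eW :
  exists e : 'rV[R]_n, (forall i, 0 < e ord0 i) /\ e *m Wstar y (Wt X lev) = 0.
Hypothesis ab : forall j, (a j < 0 /\ b j = 0) \/ 0 < b j.
Hypothesis aq : forall j, 0 < 2 * a j + (qj j)%:R - 1.

Lemma posterior_integral_le_series : exists2 K, 0 < K & exists2 D, 0 <= D &
  (iter_integral [set tau : R | (0 < tau)%R] r (fun tau =>
     iter_integral [set: R] q (fun uf =>
       iter_integral [set: R] p (fun bf => (posterior_integrand tau uf bf)%:E))) <=
   \sum_(N <oo)
     (shell_mass F N * (D * (K * N.+1%:R) `^ (p%:R + t_exp qj a b)))%:E)%E.
Proof.
have [K K_gt0 hK] := glmm_dominating_observation p_gt0 q_gt0 X1 rkW eW.
exists K => //.
have /choice[D hD] j := precision_integral_le (q_gt0 j) gauss_const_gt0 (ab j) (aq j).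
(* At radius 1 the bound is [D j] itself, and it dominates a nonnegative integral. *)
have D_ge0 j : 0 <= D j.
  have := hD j 1 ltr01; rewrite powR1 mulr1 -lee_fin; apply: le_trans.
  apply: integral_ge0 => x _; rewrite lee_fin.
  exact: precision_factor_ge0.
exists (2 ^+ p * \prod_j D j); first by rewrite mulr_ge0 ?exprn_ge0 ?prodr_ge0.
pose rho N := K * N.+1%:R.
have rho_gt0 N : 0 < rho N by rewrite mulr_gt0.
have rho_ge0 N : 0 <= rho N by rewrite ltW.
have rho2_ge0 N : 0 <= 2 * rho N by exact: mulr_ge0.
have mpos : measurable [set tau : R | 0 < tau].
  rewrite (_ : [set _ | _] = `]0%R, +oo[%classic); first exact: measurable_itv.
  by apply/seteqP; split => x /=; rewrite in_itv/= andbT.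
(* Innermost integral: prior and effect factors are constant in [beta], and each ball has length
   [2 * rho N] wherever its centre is. *)
have beta_le tau uf :
    (iter_integral [set: R] p (fun bf => (posterior_integrand tau uf bf)%:E) <=
     \sum_(N <oo) (shell_mass F N * (prior_weight tau *
       \prod_(l < q) effect_factor tau (rho N) l uf (uf l)) *
       \prod_(k < p) (2 * rho N))%:E)%E.
  apply: (@iter_integral_series_le _ _ measurableT _ _ _
    (fun N k v => intercept_ball (rho N) uf k)).
  - move=> N; apply: mulr_ge0; first exact: shell_mass_ge0.
    apply: mulr_ge0; first exact: prior_weight_ge0.
    by apply: prodr_ge0 => l _; exact: effect_factor_ge0.
  - by move=> N k v x; rewrite ler0n.
  - move=> N k v; apply: measurableT_comp => //; apply: measurable_fun_ler => //.
    apply: measurableT_comp => //; exact: measurable_funD.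
  - by [].
  - by move=> N k v; exact: integral_indic_ball_le.
  - move=> bf _; split; first by rewrite lee_fin posterior_integrand_ge0.
    apply: posterior_integrand_le_series => //.
    have [i hi] := hK (\col_k bf k) (\col_k uf k); exists i.
    case: hi => h1 h2; split=> [k|j k k0].
      have := h1 k; rewrite mxE; under eq_bigr do rewrite mxE.
      exact.
    by have := h2 j k k0; rewrite !mxE.
(* Middle integral: the balls for [beta] have become constants, and what remains is a product over
   the columns of [Z]. *)
have u_le tau : (forall j, 0 < tau j) ->
    (iter_integral [set: R] q (fun uf =>
       iter_integral [set: R] p (fun bf => (posterior_integrand tau uf bf)%:E)) <=
     \sum_(N <oo) (shell_mass F N * (2 * rho N) ^+ p *
       \prod_j precision_factor (qj j) (a j) (b j) gauss_const (rho N) (tau j))%:E)%E.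
  move=> tau_gt0.
  under [X in (_ <= X)%E]eq_eseriesr do rewrite -prior_effect_massE mulrA.
  apply: (@iter_integral_series_le _ _ measurableT _ _ _
    (fun N l v => effect_factor tau (rho N) l v)).
  - move=> N; rewrite mulr_ge0 ?prior_weight_ge0// mulr_ge0 ?shell_mass_ge0//.
    exact: exprn_ge0.
  - by move=> N l v x; exact: effect_factor_ge0.
  - by move=> N l v; exact: measurable_effect_factor.
  - move=> N l v w vw; apply/funext => x; rewrite /effect_factor.
    case: ifPn => // l0; rewrite vw//.
    (* Within one effect the columns are ordered by level, so a nonzero level comes after the
       reference level. *)
    have := tagnat.lt_Rank (Ordinal (q_gt0 (tagnat.sig1 l))) (tagnat.sig2 l).
    by rewrite tagnat.sig2K !ltEord/= => ->; rewrite lt0n.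
  - by move=> N l v; exact: integral_effect_factor_le.
  - move=> uf _; split.
      by apply: iter_integral_ge0 => bf _; rewrite lee_fin posterior_integrand_ge0.
    apply: le_trans (beta_le tau uf) _; apply: lee_nneseries => [N _ _|N _].
      rewrite lee_fin; apply: mulr_ge0; last by apply: prodr_ge0.
      apply: mulr_ge0; first exact: shell_mass_ge0.
      apply: mulr_ge0; first exact: prior_weight_ge0.
      by apply: prodr_ge0 => l _; exact: effect_factor_ge0.
    rewrite lee_fin prodr_const card_ord le_eqVlt; apply/orP; left; apply/eqP; ring.
(* The power [p] comes from the fixed effects and each term of [t_exp] from one precision; this
   turns the target into the product form of the last integration. *)
have tE N : 2 ^+ p * \prod_j D j * rho N `^ (p%:R + t_exp qj a b) =
    (2 * rho N) ^+ p * \prod_j (D j *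
      rho N `^ (- 2 * a j * (b j == 0)%R%:R + ((qj j)%:R - 1) * (0 < b j)%R%:R)).
  rewrite gt0_powRD// powR_mulrn// [(2 * rho N) ^+ p]exprMn big_split/=.
  have -> : rho N `^ t_exp qj a b = \prod_j
      rho N `^ (- 2 * a j * (b j == 0)%R%:R + ((qj j)%:R - 1) * (0 < b j)%R%:R).
    rewrite /t_exp; elim/big_rec2: _ => [|j e P _ <-]; first by rewrite powRr0.
    by rewrite gt0_powRD.
  ring.
under [X in (_ <= X)%E]eq_eseriesr do rewrite tE mulrA.
apply: (@iter_integral_series_le _ _ mpos _ _ _
  (fun N j v => precision_factor (qj j) (a j) (b j) gauss_const (rho N))).
- move=> N; rewrite mulr_ge0 ?shell_mass_ge0//.
  exact: exprn_ge0.
- by move=> N j v x; exact: precision_factor_ge0.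
- by move=> N j v; apply: measurable_funTS; exact: measurable_precision_factor.
- by [].
- by move=> N j v; exact: hD.
- move=> tau tau_gt0; split; last exact: u_le.
  apply: iter_integral_ge0 => uf _; apply: iter_integral_ge0 => bf _.
  by rewrite lee_fin posterior_integrand_ge0.
Qed.

End posterior.

Theorem theorem1 (R : realType) (F : cumulativeBounded (0 : R) (1 : R))
  (n p r : nat) (qj : 'I_r -> nat)
  (X : 'M[R]_(n, p)) (lev : forall j : 'I_r, 'I_n -> 'I_(qj j))
  (y : 'I_n -> bool) (a b : 'I_r -> R) :
  (* design structure *)
  (0 < p)%N ->
  (forall (i : 'I_n) (k : 'I_p), val k = 0%N -> X i k = 1) ->
  (forall j, (0 < qj j)%N) ->
  (* (B1) *)
  (forall j, (a j < 0 /\ b j = 0 /\ (2 <= qj j)%N) \/ 0 < b j) ->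
  (* (B2) *)
  (forall j, 0 < 2 * a j + (qj j)%:R - 1) ->
  (* (B3) *)
  \rank (Wt X lev) = (p + \sum_(j < r) (qj j).-1)%N ->
  (* (B4) *)
  (exists e : 'rV[R]_n, (forall i, 0 < e ord0 i) /\ e *m Wstar y (Wt X lev) = 0) ->
  (* (B5) *)
  (\int[lebesgue_stieltjes_measure F]_x
      ((`|x| `^ (p%:R + t_exp qj a b))%:E) < +oo)%E ->
  (iter_integral [set tau : R | (0 < tau)%R] r (fun tau =>
     iter_integral [set: R] (\sum_(j < r) qj j)%N (fun uf =>
       iter_integral [set: R] p (fun bf =>
         let beta : 'cV[R]_p := \col_k bf k in
         let u : 'cV[R]_(\sum_(j < r) qj j) := \col_k uf k in
         let eta : 'cV[R]_n := (X *m beta + Zmat lev *m u)%R in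
         (((\prod_(i < n) (F (eta i ord0) ^+ y i * (1 - F (eta i ord0)) ^+ (~~ y i)))
          * \prod_(j < r)
              (tau j `^ ((qj j)%:R / 2 + a j - 1)
               * expR (- tau j * (b j + 2^-1 *
                   ((submxcol u j)^T *m submxcol u j) ord0 ord0))))%R)%:E)))
   < +oo)%E.

Proof.
move=> p_gt0 X1 q_gt0 ab aq rkW eW moment.
have ab' j : (a j < 0 /\ b j = 0) \/ 0 < b j.
  by case: (ab j) => [[? []]|]; [left|right].
have [K K_gt0 [D D_ge0 le_series]] :=
  posterior_integral_le_series F q_gt0 p_gt0 X1 rkW eW ab' aq.
apply: le_lt_trans le_series _.
(* Each term of [t_exp] is [-2 a_j > 0] or [q_j - 1 >= 0]; a nonnegative exponent is what the
   comparison of shells with the moment asks for. *)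
have t_ge0 : 0 <= p%:R + t_exp qj a b.
  rewrite addr_ge0// sumr_ge0// => j _; case: (ab' j) => [[a_lt0 ->]|b_gt0].
    by rewrite eqxx ltxx mulr1 mulr0 addr0; lra.
  rewrite (gt_eqF b_gt0) b_gt0 mulr0 mulr1 add0r subr_ge0.
  by rewrite ler1n.
set t := p%:R + _ in t_ge0 moment *.
(* The constants [D] and [K] factor out, which leaves exactly the shell version of the moment in
   (B5). *)
have -> : (\sum_(N <oo) (shell_mass F N * (D * (K * N.+1%:R) `^ t))%:E)%E =
    ((D * K `^ t)%:E * \sum_(N <oo) (shell_mass F N * N.+1%:R `^ t)%:E)%E.
  rewrite -nneseriesZl; last first.
    by move=> N _; rewrite lee_fin mulr_ge0 ?powR_ge0 ?shell_mass_ge0.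
  apply: eq_eseriesr => N _; rewrite -EFinM powRM ?ltW//.
  by congr (_%:E); ring.
apply: lte_mul_pinfty => //; first by rewrite lee_fin mulr_ge0 ?powR_ge0.
exact: shell_moment_lty.
Qed.
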